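(* Let $\Gamma$, $\Sigma$ and $\Delta$ be graphs with the following properties. (i) $\Gamma$ is locally $\Sigma$, and every $\mu$-graph of $\Sigma$ is isomorphic to $\Delta$. (ii) $\Sigma$ is the complement of the point graph of a thick generalised quadrangle of order $(s,t)$ for some positive integers $s$ and $t$. Then $\Gamma$ has the unique $x$ property.
   Context: All graphs are undirected and simple with non-empty vertex set $V\Gamma$. For $u\in V\Gamma$, $\Gamma_i(u)$ is the set of vertices at distance $i$ from $u$, and $\Gamma(u)=\Gamma_1(u)$. A graph $\Gamma$ is locally $\Sigma$ if the neighbourhood of every vertex of $\Gamma$ is non-empty and induces a graph isomorphic to $\Sigma$. A $\mu$-graph of $\Sigma$ is a subgraph induced by $\Sigma(u)\cap\Sigma(w)$ for some vertices $u,w$ at distance two in $\Sigma$. A partial linear space is a set of points with a collection of subsets called lines such that two distinct points lie in at most one line and every line contains at least two points. A generalised quadrangle is a partial linear space whose (point-line) incidence graph has diameter $4$ and in which, for $i<4$, any two vertices $a,b$ of the incidence graph at distance $i\geq 1$ are such that $b$ has exactly one neighbour at distance $i-1$ from $a$. (In particular, for each point $p$ and line $\ell$ with $p\notin\ell$, there is a unique $q\in\ell$ collinear with $p$.) It is thick if every line has at least three points and every point lies on at least three lines; it has order $(s,t)$ if every line has $s+1$ points and every point lies on $t+1$ lines. The point graph has the points as vertices, two distinct points being adjacent when they are collinear. A non-complete graph $\Gamma$ has the unique $x$ property if for some $u\in V\Gamma$, $v\in\Gamma(u)$ and $w\in\Gamma_2(u)\cap\Gamma(v)$, there exists a unique $x\in\Gamma(u)\cap\Gamma_2(v)$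 such that $\Gamma(u)\cap\Gamma(v)\cap\Gamma(w)=\Gamma(u)\cap\Gamma(v)\cap\Gamma(x)$. *)

(* Defs.v *)
From mathcomp Require Import all_boot all_classical.

Set Implicit Arguments.
Unset Strict Implicit.
Unset Printing Implicit Defensive.

Local Open Scope classical_set_scope.

(** Graphs may be infinite, so adjacency is a [Prop]-valued relation on an
    arbitrary type. Non-emptiness is kept as the separate predicate
    [nonempty_graph] so that induced subgraphs are always graphs. *)
Record graph : Type := Graph {
  vertex :> Type;
  adj : vertex -> vertex -> Prop;
  adj_sym : forall u v, adj u v -> adj v u;
  adj_irrefl : forall u, ~ adj u u }.

Definition nonempty_graph (G : graph) : Prop := inhabited G.

Definition isomorphic (G H : graph) : Prop :=
  exists2 f : G -> H, bijective f & forall u v, adj u v <-> adj (f u) (f v).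

Definition complete (G : graph) : Prop := forall u v : G, u <> v -> adj u v.

Definition complement (G : graph) : graph.
Proof.
refine (@Graph G (fun u v => u <> v /\ ~ adj u v) _ _).
- by move=> u v [uv nuv]; split=> [/esym //|/adj_sym].
- by move=> u [].
Defined.

(** The vertices are the elements of [set_type A], i.e. [{x | x \in A}]. *)
Definition induced (G : graph) (A : set G) : graph.
Proof.
refine (@Graph (set_type A) (fun u v => adj (val u) (val v)) _ _).
- by move=> u v /adj_sym.
- by move=> u /adj_irrefl.
Defined.

Fixpoint walk (G : graph) (n : nat) (u v : G) : Prop :=
  if n is n'.+1 then exists2 w, adj u w & walk n' w v else u = v.

Definition at_distance (G : graph) (i : nat) (u v : G) : Prop :=
  walk i u v /\ forall j, (j < i)%N -> ~ walk j u v.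

Definition sphere (G : graph) (i : nat) (u : G) : set G :=
  [set v | at_distance i u v].

Definition nbr (G : graph) (u : G) : set G := [set v | adj u v].

Lemma sphere1 (G : graph) (u : G) : sphere 1 u = nbr u.
Proof.
apply/seteqP; split=> v; rewrite /sphere /nbr /at_distance /=.
  by move=> [[w uw <-]].
move=> uv; split; first by exists v.
by case=> // _ uEv; move: uv; rewrite uEv => /adj_irrefl.
Qed.

(** In particular the graph is connected. *)
Definition has_diameter (G : graph) (d : nat) : Prop :=
  (forall u v : G, exists2 i, (i <= d)%N & at_distance i u v) /\
  (exists u v : G, at_distance d u v).

Definition locally (G S : graph) : Prop :=
  forall u : G, nbr u !=set0 /\ isomorphic (induced (nbr u)) S.

Definition mu_graphs_isomorphic_to (S D : graph) : Prop :=
  forall u w : S, at_distance 2 u w ->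
    isomorphic (induced (nbr u `&` nbr w)) D.

Definition unique_x_property (G : graph) : Prop :=
  ~ complete G /\
  exists u v w : G,
    [/\ nbr u v, (sphere 2 u `&` nbr v) w &
      exists! x : G, (nbr u `&` sphere 2 v) x /\
        nbr u `&` nbr v `&` nbr w = nbr u `&` nbr v `&` nbr x].

Record partial_linear_space : Type := PartialLinearSpace {
  pls_point : Type;
  pls_line : set (set pls_point);
  line_inj : forall p q : pls_point, p <> q ->
    forall l m, pls_line l -> pls_line m -> l p -> l q -> m p -> m q -> l = m;
  line_ge2 : forall l, pls_line l -> (`I_2 #<= l)%card }.

Definition incident (Q : partial_linear_space)
    (a b : pls_point Q + set_type (@pls_line Q)) : Prop :=
  match a, b with
  | inl p, inr l => (val l : set (pls_point Q)) p
  | inr l, inl p => (val l : set (pls_point Q)) p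
  | _, _ => False
  end.

Definition incidence_graph (Q : partial_linear_space) : graph.
Proof.
refine (@Graph _ (@incident Q) _ _).
- by move=> [p|l] [q|m].
- by move=> [p|l].
Defined.

Definition point_graph (Q : partial_linear_space) : graph.
Proof.
refine (@Graph (pls_point Q)
  (fun p q => p <> q /\ exists l, [/\ pls_line l, l p & l q]) _ _).
- move=> p q [pq [l [Ll lp lq]]]; split; first by move/esym.
  by exists l.
- by move=> p [].
Defined.

Definition generalised_quadrangle (Q : partial_linear_space) : Prop :=
  has_diameter (incidence_graph Q) 4 /\
  forall (i : nat) (a b : incidence_graph Q),
    (1 <= i)%N -> (i < 4)%N -> at_distance i a b ->
    exists! c, nbr b c /\ at_distance (i - 1) a c.

Definition lines_through (Q : partial_linear_space) (p : pls_point Q) :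
  set (set (pls_point Q)) := [set l | pls_line l /\ l p].

Definition thick (Q : partial_linear_space) : Prop :=
  (forall l : set (pls_point Q), pls_line l -> (`I_3 #<= l)%card) /\
  (forall p : pls_point Q, (`I_3 #<= lines_through p)%card).

Definition has_order (Q : partial_linear_space) (s t : nat) : Prop :=
  (forall l : set (pls_point Q), pls_line l -> (l #= `I_s.+1)%card) /\
  (forall p : pls_point Q, (lines_through p #= `I_t.+1)%card).

(* Main.v *)
Require Import Defs.
From mathcomp Require Import all_boot all_classical.

(** Fix adjacent [u] and [v], put [B = nbr u `&` nbr v], and call two vertices
    of [nbr u] (or of [nbr v]) perpendicular when they are not adjacent: this is
    collinearity in a generalised quadrangle [Q_u] (or [Q_v]).  Both quadrangles
    induce the same relation on [B], where [B] consists of the points of [Q_v]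
    not perpendicular to [u] and of the points of [Q_u] not perpendicular to
    [v].  Let [b], [c] in [B] be two points of a line of [Q_v] through [w], and
    let [x] be the point of the line [bc] of [Q_u] perpendicular to [v].  A point
    of [B] is perpendicular to the point at infinity of the line [bc] exactly
    when it lies on [bc] or is perpendicular to no point of [bc] in [B].  This
    criterion only mentions [B], so [w] and [x] have the same non-neighbours in
    [B]; and two points of [B] on a line through [x] determine [x]. *)

Set Implicit Arguments.
Unset Strict Implicit.
Unset Printing Implicit Defensive.

Local Open Scope classical_set_scope.

(** Here [c] is the reflexive collinearity relation, so that for distinct [a] and
    [b] with [c a b] the line [ab] is the set of [p] with [c p a] and [c p b]. *)
Record gq_collinearity (T : Type) (A : set T) (c : T -> T -> Prop) : Prop :=
  GQCollinearity {
  gqc_sym : forall a b, c a b -> c b a;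
  gqc_neighbour : forall a, A a -> exists b, [/\ A b, b <> a & c a b];
  gqc_line : forall a b p q, A a -> A b -> A p -> A q ->
    a <> b -> c a b -> c p a -> c p b -> c q a -> c q b -> c p q;
  gqc_proj : forall a b p, A a -> A b -> A p -> a <> b -> c a b ->
    exists q, [/\ A q, c p q, c q a & c q b];
  gqc_third : forall a b, A a -> A b -> a <> b -> c a b ->
    exists q, [/\ A q, q <> a, q <> b, c q a & c q b];
  gqc_off : forall a b, A a -> A b -> a <> b -> c a b ->
    exists q, [/\ A q, c q a & ~ c q b] }.

(** Symmetry of [cS] is assumed separately because [gqc_sym] is not restricted to [A], where alone
    [f] gives information. *)
Lemma gqc_preimage (S T : Type) (A : set S) (f : set_type A -> T)
    (cS : S -> S -> Prop) (cT : T -> T -> Prop) :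
    bijective f ->
    (forall p q : set_type A, cS (val p) (val q) <-> cT (f p) (f q)) ->
    (forall a b, cS a b -> cS b a) ->
  gq_collinearity setT cT -> gq_collinearity A cS.
Proof.
move=> [g fK gK] cE symS [_ nb li pr th off].
pose F a (Aa : A a) := f (SigSub (mem_set Aa)).
have FE a b (Aa : A a) (Ab : A b) : cS a b <-> cT (F a Aa) (F b Ab).
  exact: (cE (SigSub (mem_set Aa)) (SigSub (mem_set Ab))).
have F_neq a b (Aa : A a) (Ab : A b) : a <> b -> F a Aa <> F b Ab.
  by move=> ab /(can_inj fK) /(congr1 val).
have F_surj y : exists a (Aa : A a), y = F a Aa.
  exists (val (g y)), (set_mem (valP (g y))); rewrite /F -[LHS]gK.
  by congr f; apply: val_inj.
split => //.
- move=> a Aa; have [y [_ yn]] := nb (F a Aa) I.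
  have [b [Ab yE]] := F_surj y; subst y.
  move=> /FE ab; exists b; split=> // ba; subst b.
  by apply: yn; rewrite (Prop_irrelevance Aa Ab).
- move=> a b p q Aa Ab Ap Aq ab /(FE _ _ Aa Ab) h1 /(FE _ _ Ap Aa) h2.
  move=> /(FE _ _ Ap Ab) h3 /(FE _ _ Aq Aa) h4 /(FE _ _ Aq Ab) h5.
  by apply/(FE _ _ Ap Aq); apply: li h1 h2 h3 h4 h5 => //; apply: F_neq.
- move=> a b p Aa Ab Ap ab /(FE _ _ Aa Ab) h1.
  have [y [_]] := pr _ _ (F p Ap) I I I (F_neq _ _ Aa Ab ab) h1.
  have [q [Aq ->]] := F_surj y.
  by move=> /FE ? /FE ? /FE ?; exists q.
- move=> a b Aa Ab ab /(FE _ _ Aa Ab) h1.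
  have [y [_ ya yb]] := th _ _ I I (F_neq _ _ Aa Ab ab) h1.
  have [q [Aq yE]] := F_surj y; subst y.
  move=> /FE ? /FE ?; exists q; split=> // qE; subst q.
  + by apply: ya; rewrite (Prop_irrelevance Aa Aq).
  + by apply: yb; rewrite (Prop_irrelevance Ab Aq).
- move=> a b Aa Ab ab /(FE _ _ Aa Ab) h1.
  have [y [_]] := off _ _ I I (F_neq _ _ Aa Ab ab) h1.
  have [q [Aq ->]] := F_surj y.
  by move=> /FE ? nqb; exists q; split=> // /(FE _ _ Aq Ab).
Qed.

(** * Points at infinity with respect to a fixed point *)

Section QuadrangleCollinearity.
Variables (T : Type) (A : set T) (c : T -> T -> Prop).
Hypothesis cP : gq_collinearity A c.
Let csym := gqc_sym cP.

(** If [x] and [y] differed, [b] and [p] would both lie on the line [xy], hence be perpendicular. *)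
Lemma perp_unique (p x y b : T) : A p -> A x -> A y -> A b ->
  c x p -> c y p -> c x y -> c b x -> c b y -> ~ c b p -> x = y.
Proof.
move=> Ap Ax Ay Ab xp yp xy bx by_ nbp; apply: contrapT => nxy.
by apply: nbp; apply: (gqc_line cP Ax Ay Ab Ap nxy) => //; apply: csym.
Qed.

(** Here [x] is the point at infinity of the line [bb'] relative to [p]. If [d] is perpendicular to
    [x] and to another point of this line, it lies on the line. Conversely, if [d] is perpendicular
    to no point of the line outside the perp of [p], its projection to the line is perpendicular to
    [p] and so equals [x]. *)
Lemma perp_infinity (p b b' x d : T) : A p -> A b -> A b' -> A x -> A d ->
    b <> b' -> c b b' -> c x p -> c x b -> c x b' -> ~ c b p ->
  c d x <-> (c d b /\ c d b') \/
    forall g, A g -> ~ c g p -> c g b -> c g b' -> ~ c d g.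
Proof.
move=> Ap Ab Ab' Ax Ad nbb' bb' xp xb xb' nbp.
have line q r : A q -> A r -> c q b -> c q b' -> c r b -> c r b' -> c q r.
  by move=> Aq Ar; apply: (gqc_line cP Ab Ab').
split=> [dx|[[db db']|noB]].
- have [|meet] := pselect (c d b /\ c d b'); first by left.
  right=> g Ag ngp gb gb' dg; apply: meet.
  have ngx : g <> x by move=> gx; apply: ngp; rewrite gx.
  have gx : c g x by apply: line.
  by split; apply: (gqc_line cP Ag Ax Ad _ ngx) => //; apply: csym.
- exact: line.
- have [g [Ag dg gb gb']] := gqc_proj cP Ab Ab' Ad nbb' bb'.
  have gp : c g p by apply: contrapT => ngp; apply: (noB g).
  suff <- : g = x by [].
  by apply: (@perp_unique p g x b) => //; [exact: line|exact: csym|exact: csym].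
Qed.

End QuadrangleCollinearity.

Lemma card_ge3_avoid (T : Type) (A : set T) (a b : T) :
  (`I_3 #<= A)%card -> exists q, [/\ A q, q <> a & q <> b].
Proof.
move=> A3; apply: contrapT => nex.
have subA : A `<=` (fun i => if i is 0%N then a else b) @` `I_2.
  move=> q Aq; have [qa|na] := pselect (q = a); first by exists 0%N.
  have [qb|nb] := pselect (q = b); first by exists 1%N.
  by case: nex; exists q.
have := card_le_trans A3 (card_le_trans (subset_card_le subA) (card_image_le _ _)).
by rewrite card_le_II.
Qed.

(** * From the incidence graph to collinearity *)

Section Quadrangle.
Variable Q : partial_linear_space.
Hypotheses (gqQ : generalised_quadrangle Q) (thickQ : thick Q).

Let collinear (p q : pls_point Q) : Prop :=
  exists l, [/\ pls_line l, l p & l q].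

Lemma collinear_sym p q : collinear p q -> collinear q p.
Proof. by move=> [l [Ll lp lq]]; exists l. Qed.

Lemma walk2_points p q : @walk (incidence_graph Q) 2 (inl p) (inl q) <->
  collinear p q.
Proof.
split=> [[[//|m] pm [y my ye]]|[l [Ll lp lq]]].
  by rewrite ye /= in my; exists (val m); split=> //; apply: (set_mem (valP m)).
by exists (inr (SigSub (mem_set Ll))) => //; exists (inl q).
Qed.

Lemma distance2_points p q : p <> q -> collinear p q ->
  @at_distance (incidence_graph Q) 2 (inl p) (inl q).
Proof.
move=> pq /walk2_points pqw; split=> // [[|[|//]]] _; first by case.
by move=> [y py ye]; rewrite ye in py.
Qed.

Lemma walk3_point_line p l (Ll : pls_line l) :
    @walk (incidence_graph Q) 3 (inl p) (inr (SigSub (mem_set Ll))) <->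
  exists2 q, l q & collinear p q.
Proof.
split=> [[[//|m] pm [[q|//] mq [y qy ye]]]|[q lq /walk2_points[y py [z yz ze]]]].
  rewrite ye /= in qy; exists q => //; exists (val m).
  by split=> //; apply: (set_mem (valP m)).
by exists y => //; exists z => //; exists (inr (SigSub (mem_set Ll))); rewrite ?ze.
Qed.

Lemma distance3_point_line p l (Ll : pls_line l) : ~ l p ->
    (exists2 q, l q & collinear p q) ->
  @at_distance (incidence_graph Q) 3 (inl p) (inr (SigSub (mem_set Ll))).
Proof.
move=> nlp /(walk3_point_line _ Ll) w3; split=> // [[|[|[|//]]]] _ //.
  by move=> [y py ye]; rewrite ye in py.
by move=> [[//|m] _ [y my ye]]; rewrite ye in my.
Qed.

(** Two such points would be two neighbours of [l] at distance 2 from [p] in the incidence graph,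
    while [l] is at distance 3. *)
Lemma collinear_uniq p l a b : pls_line l -> ~ l p -> l a -> l b ->
  collinear p a -> collinear p b -> a = b.
Proof.
move=> Ll nlp la lb pa pb.
have npE q : l q -> p <> q by move=> lq pq; apply: nlp; rewrite pq.
have d3 : at_distance 3 _ _ := @distance3_point_line p l Ll nlp (ex_intro2 _ _ a la pa).
have [y [_ yu]] := gqQ.2 3 _ _ isT isT d3.
have yE q : l q -> collinear p q -> y = inl q.
  by move=> lq pq; apply: yu; split=> //; apply: distance2_points => //; apply: npE.
by have := yE a la pa; rewrite (yE b lb pb) => -[].
Qed.

Lemma collinear_exists p l : pls_line l -> exists2 q, l q & collinear p q.
Proof.
move=> Ll; have [lp|nlp] := pselect (l p); first by exists p => //; exists l.
(* The distance is at most 4, and odd since the incidence graph is bipartite; distance 1 is excluded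
   by [nlp]. *)
have [[|[|[|[|[|//]]]]] _ [wi _]] := gqQ.1.1 (inl p) (inr (SigSub (mem_set Ll))).
- by [].
- by case: wi => y py ye; rewrite ye in py.
- by case: wi => [[//|m] _ [y my ye]]; rewrite ye in my.
- by apply/(walk3_point_line _ Ll).
- case: wi => [[//|m] _ [[q|//] _ [[//|n] _ [y ny ye]]]].
  by rewrite ye in ny.
Qed.

Lemma collinear_refl p : collinear p p.
Proof.
(* Both [set0] are placeholders: any line through [p] will do. *)
have [l [[Ll lp] _ _]] := card_ge3_avoid set0 set0 (thickQ.2 p).
by exists l.
Qed.

Lemma gqc_collinear : gq_collinearity setT collinear.
Proof.
have on_line a b l p : pls_line l -> l a -> l b -> a <> b ->
    collinear p a -> collinear p b -> l p.
  move=> Ll la lb ab pa pb; apply: contrapT => nlp.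
  by apply: ab; apply: collinear_uniq nlp _ _ pa pb.
split.
- exact: collinear_sym.
- move=> a _; have [l [Ll la _]] := collinear_refl a.
  have [b [lb ba _]] := card_ge3_avoid a a (thickQ.1 l Ll).
  by exists b; split=> //; exists l.
- move=> a b p q _ _ _ _ ab [l [Ll la lb]] pa pb qa qb; exists l.
  by split=> //; [apply: on_line pa pb|apply: on_line qa qb].
- move=> a b p _ _ _ ab [l [Ll la lb]].
  have [q lq pq] := collinear_exists p Ll.
  by exists q; split=> //; exists l.
- move=> a b _ _ ab [l [Ll la lb]].
  have [q [lq qa qb]] := card_ge3_avoid a b (thickQ.1 l Ll).
  by exists q; split=> //; exists l.
- move=> a b _ _ ab [l [Ll la lb]].
  (* Take [q] on a second line [m] through [a]. Were [q] collinear with [b], it would lie on [l],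
     and [l] and [m] would share [a] and [q]. *)
  have [m [[Lm ma] ml _]] := card_ge3_avoid l l (thickQ.2 a).
  have [q [mq qa _]] := card_ge3_avoid a a (thickQ.1 m Lm).
  have colqa : collinear q a by exists m.
  exists q; split=> // colqb; apply: ml.
  apply: (line_inj qa) => //; exact: on_line colqa colqb.
Qed.

Lemma nonadj_complement_point_graph (p q : pls_point Q) :
  ~ @adj (complement (point_graph Q)) p q <-> collinear p q.
Proof.
split=> [/not_andP[/contrapT ->|/contrapT[]//]|pq [npq]].
  exact: collinear_refl.
by case.
Qed.

End Quadrangle.

(** * The quadrangles on the neighbourhoods, and the main proof *)

Lemma isomorphic_gqc (G H : graph) (A : set G) (S : graph) :
    isomorphic (induced A) S -> isomorphic S H ->
    gq_collinearity setT (fun p q : H => ~ adj p q) ->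
  gq_collinearity A (fun p q => ~ adj p q).
Proof.
move=> [f bf fE] [g bg gE]; apply: (gqc_preimage (bij_comp bg bf)).
  by move=> p q; apply: not_iff_compat; rewrite -gE -fE.
by move=> a b nab /adj_sym.
Qed.

Lemma sphere2P (G : graph) (u w : G) :
  sphere 2 u w <-> [/\ u <> w, ~ adj u w & exists2 v, adj u v & adj v w].
Proof.
split=> [[[v uv [y vy yw]] dw]|[uw nuw [v uv vw]]].
  split; first by move=> uw; apply: (dw 0%N).
    by move=> auw; apply: (dw 1%N) => //; exists w.
  by exists v; rewrite -?yw.
split; first by exists v => //; exists w.
by move=> [|[|//]] // _ [y uy yw]; apply: nuw; rewrite -yw.
Qed.

Theorem lemma4p6 (Gamma Sigma Delta : graph)
    (Gamma_nonempty : nonempty_graph Gamma)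
    (Sigma_nonempty : nonempty_graph Sigma)
    (Delta_nonempty : nonempty_graph Delta)
    (Gamma_locally_Sigma : locally Gamma Sigma)
    (Sigma_mu_graphs : mu_graphs_isomorphic_to Sigma Delta)
    (Sigma_complement_GQ :
      exists (Q : partial_linear_space) (s t : nat),
        (0 < s)%N /\ (0 < t)%N /\
        generalised_quadrangle Q /\ thick Q /\ has_order Q s t /\
        isomorphic Sigma (complement (point_graph Q))) :
  unique_x_property Gamma.
Proof.
case: Sigma_complement_GQ => Q [s [t [_ [_ [gqQ [thQ [_ SigmaQ]]]]]]].
have gqG (u : Gamma) : gq_collinearity (nbr u) (fun p q => ~ adj p q).
  have := isomorphic_gqc (Gamma_locally_Sigma u).2 SigmaQ.
  have -> : (fun p q => ~ @adj (complement (point_graph Q)) p q) =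
      fun p q => exists l, [/\ pls_line l, l p & l q].
    by apply/funext => p; apply/funext => q; apply/propext;
      exact: nonadj_complement_point_graph.
  by apply; apply: gqc_collinear.
have nnsym (a b : Gamma) : adj a b -> ~ ~ adj b a.
  by move=> ab nba; apply: nba; apply: adj_sym.
have [u] := Gamma_nonempty; have [v uv] := (Gamma_locally_Sigma u).1.
have vu : adj v u := adj_sym uv.
have nsym (a b : Gamma) : ~ adj a b -> ~ adj b a by move=> nab /adj_sym.
have [w [vw nwu nuw]] := gqc_neighbour (gqG v) vu.
have nwu' : ~ adj w u := nsym _ _ nuw.
(* In [Q_v], the line [wb] passes through [w] and differs from the line [wu]. *)
have [b [vb bw ub]] := gqc_off (gqG v) vw vu nwu nwu'.
have {}ub : adj u b := adj_sym (contrapT ub).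
have nwb : w <> b by move=> wb; apply: nwu'; rewrite wb; apply: adj_sym.
have [c [vc ncw ncb cw cb]] := gqc_third (gqG v) vw vb nwb (nsym _ _ bw).
(* On the line [wb] of [Q_v], only [w] is perpendicular to [u]. *)
have uc : adj u c.
  apply: contrapT => nuc; apply: ncw.
  exact: (perp_unique (gqG v) vu vc vw vb (nsym _ _ nuc) nwu' cw
    (nsym _ _ cb) bw (nnsym _ _ ub)).
have bc : ~ adj b c := nsym _ _ cb.
have nbc : b <> c by exact: nesym.
have [x [ux nvx xb xc]] := gqc_proj (gqG u) ub uc uv nbc bc.
have vx : v <> x by move=> vx; apply: xb; rewrite -vx.
split; first by move=> /(_ u w (nesym nwu)).
exists u, v, w; split=> //.
  by split=> //; apply/sphere2P; split=> //; [exact: nesym|exists v].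
have perpE d : adj u d -> adj v d -> ~ adj d w <-> ~ adj d x.
  move=> ud vd.
  have Ew := perp_infinity (gqG v) vu vb vc vw vd nbc bc nwu'
    (nsym _ _ bw) (nsym _ _ cw) (nnsym _ _ ub).
  have Ex := perp_infinity (gqG u) uv ub uc ux ud nbc bc (nsym _ _ nvx)
    xb xc (nnsym _ _ vb).
  (* The quantified [g] ranges over the same set in [Ew] and [Ex]: being in [nbr v] and not
     perpendicular to [u], or in [nbr u] and not perpendicular to [v], both mean being in [B]. *)
  rewrite Ew Ex; split=> -[|H]; [by left|right|by left|right].
    by move=> g ug /contrapT gv; apply: H; [exact: adj_sym|exact: nnsym].
  by move=> g vg /contrapT gu; apply: H; [exact: adj_sym|exact: nnsym].
exists x; split.
  split; first by split=> //; apply/sphere2P; split=> //; exists u.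
  by apply/seteqP; split=> d [[ud vd] dw]; split=> //;
    apply: adj_sym; apply: contrapT => /(perpE d ud vd); apply; exact: adj_sym.
move=> x' [[ux' /sphere2P[_ nvx' _]] NE].
have perp' d : adj u d -> adj v d -> ~ adj d w -> ~ adj x' d.
  move=> ud vd dw x'd.
  have : (nbr u `&` nbr v `&` nbr x') d by [].
  by rewrite -NE => -[_ /adj_sym].
have x'b := perp' b ub vb bw; have x'c := perp' c uc vc cw.
(* Both [x] and [x'] lie on the line [bc] of [Q_u] and are perpendicular to [v], whereas [b] is
   not. *)
apply: (perp_unique (gqG u) uv ux ux' ub (nsym _ _ nvx) (nsym _ _ nvx') _
  (nsym _ _ xb) (nsym _ _ x'b) (nnsym _ _ vb)).
exact: (gqc_line (gqG u) ub uc ux ux' nbc).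
Qed.
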